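(* Let $n \geq 2$ be an integer. There exists a simple algebra $\mathbf{A}$ whose descending central series of higher commutators $(\theta_m)_{m \geq 1}$ satisfies \[ \theta_m = 1_{\mathbf{A}} \text{ for all } 1 \le m \leq n \qquad\text{and}\qquad \theta_m = 0_{\mathbf{A}} \text{ for all } m > n . \]
   Context: An algebra is a nonempty set $A$ together with a (possibly infinite) family of finitary operations on it (the fundamental operations). $0_{\mathbf{A}}$ denotes the equality congruence and $1_{\mathbf{A}} = A\times A$ the full congruence. $\mathbf{A}$ is simple if it has exactly two congruences, $0_{\mathbf{A}}$ and $1_{\mathbf{A}}$. Higher commutator (Bulatov), in the only case needed: for $m \geq 2$, $[\underbrace{1_{\mathbf{A}},\dots,1_{\mathbf{A}}}_{m}]$ is the smallest congruence $\delta$ of $\mathbf{A}$ such that for every term $\tau(\mathbf{x}_1,\dots,\mathbf{x}_m)$ in the language of $\mathbf{A}$ (each $\mathbf{x}_i$ a finite tuple of variables) and all tuples $\mathbf{p}_i,\mathbf{q}_i$ of elements of $A$ of the same length as $\mathbf{x}_i$ ($1\le i\le m$): if $\tau^{\mathbf{A}}(\mathbf{z}_1,\dots,\mathbf{z}_{m-1},\mathbf{p}_m)\ \delta\ \tau^{\mathbf{A}}(\mathbf{z}_1,\dots,\mathbf{z}_{m-1},\mathbf{q}_m)$ for every choice of $\mathbf{z}_i\in\{\mathbf{p}_i,\mathbf{q}_i\}$ other than the choice $\mathbf{z}_i=\mathbf{q}_i$ for all $i\le m-1$ (the choices being indexed by $\{0,1\}^{m-1}$), then $\tau^{\mathbf{A}}(\mathbf{q}_1,\dots,\mathbf{q}_{m-1},\mathbf{p}_m)\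 \delta\ \tau^{\mathbf{A}}(\mathbf{q}_1,\dots,\mathbf{q}_{m-1},\mathbf{q}_m)$. In particular this commutator equals $0_{\mathbf{A}}$ if and only if the implication always holds with $\delta$ replaced by equality. The descending central series of higher commutators of $\mathbf{A}$ is defined by $\theta_1 = 1_{\mathbf{A}}$ and $\theta_m = [\underbrace{1_{\mathbf{A}},\dots,1_{\mathbf{A}}}_{m \text{ many}}]$ for $m\ge 2$. *)

(* Defs.v *)
From Stdlib Require Import RelationClasses.
From mathcomp Require Import all_boot.

Set Implicit Arguments.
Unset Strict Implicit.
Unset Printing Implicit Defensive.

(* The type [symbol] may be infinite; constants are operations of arity 0. *)
Record algebra := Algebra {
  carrier :> Type;
  symbol : Type;
  arity : symbol -> nat;
  op : forall f : symbol, ('I_(arity f) -> carrier) -> carrier;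
  carrier_nonempty : inhabited carrier
}.

Inductive term (A : algebra) (V : Type) : Type :=
| Var of V
| App (f : symbol A) of ('I_(arity f) -> term A V).

Fixpoint eval (A : algebra) (V : Type) (env : V -> A) (t : term A V) : A :=
  match t with
  | Var v => env v
  | App f args => op (fun i => eval env (args i))
  end.

Record congruence (A : algebra) (d : A -> A -> Prop) : Prop := Congruence {
  congruence_equivalence : Equivalence d;
  congruence_op : forall (f : symbol A) (a b : 'I_(arity f) -> A),
    (forall i, d (a i) (b i)) -> d (op a) (op b)
}.

Definition same_rel (T : Type) (r s : T -> T -> Prop) : Prop :=
  forall x y, r x y <-> s x y.

Definition zero_congruence (A : algebra) : A -> A -> Prop := fun x y => x = y.

Definition one_congruence (A : algebra) : A -> A -> Prop := fun _ _ => True.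

Definition simple (A : algebra) : Prop :=
  ~ same_rel (@zero_congruence A) (@one_congruence A) /\
  forall d : A -> A -> Prop, congruence d <->
    (same_rel d (@zero_congruence A) \/ same_rel d (@one_congruence A)).

(* A term in k.+1 tuples of variables, the i-th one of length l i, is a term
   whose variables are the pairs of i : 'I_k.+1 and a position in 'I_(l i).
   In [assign p q z b], z selects the values of the first k tuples and b those
   of the last one; false stands for p and true for q. *)
Definition assign (A : algebra) (k : nat) (l : 'I_k.+1 -> nat)
    (p q : forall i, 'I_(l i) -> A) (z : 'I_k -> bool) (b : bool)
    (v : {i : 'I_k.+1 & 'I_(l i)}) : A :=
  let c := if unlift ord_max (tag v) is Some j then z j else b in
  (if c then q else p) (tag v) (tagged v).

Definition term_condition (A : algebra) (k : nat) (d : A -> A -> Prop) : Prop :=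
  forall (l : 'I_k.+1 -> nat) (t : term A {i : 'I_k.+1 & 'I_(l i)})
         (p q : forall i, 'I_(l i) -> A),
    (forall z : 'I_k -> bool, ~ (forall j, z j) ->
       d (eval (assign p q z false) t) (eval (assign p q z true) t)) ->
    d (eval (assign p q (fun=> true) false) t)
      (eval (assign p q (fun=> true) true) t).

(* The higher commutator [1, ..., 1] with k.+1 entries. *)
Definition commutator_ones (A : algebra) (k : nat) : A -> A -> Prop :=
  fun x y => forall d : A -> A -> Prop,
    congruence d -> term_condition k d -> d x y.

(* Only the values at m >= 1 are meaningful. *)
Definition central_series (A : algebra) (m : nat) : A -> A -> Prop :=
  if m is k.+2 then @commutator_ones A k.+1 else @one_congruence A.

Lemma commutator_ones_smallest (A : algebra) (k : nat) :
  [/\ congruence (@commutator_ones A k),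
      term_condition k (@commutator_ones A k)
    & forall d : A -> A -> Prop, congruence d -> term_condition k d ->
        forall x y, @commutator_ones A k x y -> d x y].
Proof.
split.
- split; first split.
  + by move=> x d cd _; case: cd => -[refl_d _ _] _; apply: refl_d.
  + move=> x y xy d cd td; case: (cd) => -[_ sym_d _] _.
    exact: sym_d (xy d cd td).
  + move=> x y z xy yz d cd td; case: (cd) => -[_ _ trans_d] _.
    exact: trans_d (xy d cd td) (yz d cd td).
  + move=> f a b ab d cd td; case: (cd) => _; apply=> i.
    exact: ab i d cd td.
- by move=> l t p q h d cd td; apply: (td) => z hz; exact: h z hz d cd td.
- by move=> d cd td x y xy; exact: xy d cd td.
Qed.

(* Main.v *)
(** The algebra lives on [nat]. Its basic operations are one [N.+1]-ary
    operation [collapse], injective except that it forgets its last argument on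
    the 0-1 tuples having a 0 among the first [N] entries, and all the unary
    injections that miss 0 or miss 1.

    The unary operations give simplicity: from [a <> b] they produce [c ~ y]
    and [d ~ y] for any [c], [d] and any large [y]. The operation [collapse]
    breaks the term condition for at most [N.+1] tuples of variables. For more
    tuples the condition holds because no compound term takes both values 0 and
    1: the last argument of [collapse] can be forgotten only where it is a
    variable, and the other [N] arguments are then variables or constant, so
    that one of the [k > N] remaining tuples of variables is irrelevant to them. *)

Require Import Defs.
From Stdlib Require Import Classical_Prop.
From mathcomp Require Import all_boot.

Set Implicit Arguments.
Unset Strict Implicit.
Unset Printing Implicit Defensive.

(** * The collapsing operation and its failure of injectivity *)

Definition collapsible N (x : 'I_N.+1 -> nat) : bool :=
  [forall i, x i <= 1] && [exists i, (i != ord_max) && (x i == 0)].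

(* The offset keeps 0 and 1 out of the range. *)
Definition collapse N (x : 'I_N.+1 -> nat) : nat :=
  (pickle [ffun i => if (i == ord_max) && collapsible x then 0 else x i]).+2.

Lemma eq_collapsible N (x y : 'I_N.+1 -> nat) :
  x =1 y -> collapsible x = collapsible y.
Proof.
move=> xy; congr (_ && _); first by apply: eq_forallb => i; rewrite xy.
by apply: eq_existsb => i; rewrite xy.
Qed.

Lemma eq_collapse N (x y : 'I_N.+1 -> nat) : x =1 y -> collapse x = collapse y.
Proof.
move=> xy; rewrite /collapse (eq_collapsible xy); congr (pickle _).+2.
by apply/ffunP => i; rewrite !ffunE xy.
Qed.

(** All entries but the last are stored faithfully. If only one tuple were collapsible, its stored 0
    would be the last entry of the other, making that one collapsible too. *)
Lemma collapse_inj N (x y : 'I_N.+1 -> nat) : collapse x = collapse y ->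
  (forall i, i != ord_max -> x i = y i) /\
  (x ord_max = y ord_max \/ collapsible x /\ collapsible y).
Proof.
move=> [] /(pcan_inj pickleK) /ffunP xy.
have xy' i : i != ord_max -> x i = y i.
  by move=> im; have := xy i; rewrite !ffunE (negPf im).
split=> //; have := xy ord_max; rewrite !ffunE eqxx /=.
have exE : [exists i, (i != ord_max) && (x i == 0)] =
           [exists i, (i != ord_max) && (y i == 0)].
  by apply: eq_existsb => i; case: eqVneq => //= im; rewrite xy'.
case cx: (collapsible x); case cy: (collapsible y); try by [left | right].
- move=> ym; case/negP: (negbT cy); case/andP: cx => /forallP x1.
  rewrite /collapsible exE => ->; rewrite andbT; apply/forallP => i.
  by have [->|/xy' <-//] := eqVneq i ord_max; rewrite -ym.
- move=> xm; case/negP: (negbT cx); case/andP: cy => /forallP y1.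
  rewrite /collapsible exE => ->; rewrite andbT; apply/forallP => i.
  by have [->|/xy' ->//] := eqVneq i ord_max; rewrite xm.
Qed.

Lemma collapse_forget N (x y : 'I_N.+1 -> nat) :
  (forall i, i != ord_max -> x i = y i) -> collapsible x -> collapsible y ->
  collapse x = collapse y.
Proof.
move=> xy cx cy; rewrite /collapse cx cy; congr (pickle _).+2.
by apply/ffunP => i; rewrite !ffunE !andbT; case: eqVneq => // /xy.
Qed.

Definition misses_bit T (u : T -> nat) : Prop :=
  (forall x, u x <> 0) \/ (forall x, u x <> 1).

Lemma misses_bit_eq T (u : T -> nat) x y :
  misses_bit u -> u x <= 1 -> u y <= 1 -> u x = u y.
Proof.
case=> u_neq; move: (u_neq x) (u_neq y);
  by case: (u x) => [|[|?]] //; case: (u y) => [|[|?]].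
Qed.

Definition unary_op := {u : nat -> nat | injective u /\ misses_bit u}.

Definition collapse_arity N (f : option unary_op) : nat :=
  if f is None then N.+1 else 1.

Definition collapse_op N (f : option unary_op) :
    ('I_(collapse_arity N f) -> nat) -> nat :=
  match f with
  | None => @collapse N
  | Some u => fun x => sval u (x ord0)
  end.

Definition collapse_algebra N : algebra :=
  @Algebra nat (option unary_op) (collapse_arity N) (@collapse_op N)
    (inhabits 0).

(** * Congruences of the algebra *)

Section Simplicity.

(** Turns a pair [a ~ b] into [c ~ y]; other inputs land above [y], for injectivity when [c < y]. *)
Definition shuttle (a b c y x : nat) : nat :=
  if x == a then c else if x == b then y else (x + y).+1.

Lemma shuttle_inj a b c y : c < y -> injective (shuttle a b c y).
Proof.
move=> cy x x'; rewrite /shuttle.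
have yNS z : y <> (z + y).+1 by move=> e; have := leq_addl z y; rewrite {1}e ltnn.
have cNS z : c <> (z + y).+1.
  by move=> e; have := leq_addl z y; rewrite leqNgt (leq_trans _ cy) // e.
have cNy : c <> y by move=> e; rewrite e ltnn in cy.
case: (x =P a) => [xa|_]; case: (x' =P a) => [x'a|_];
  case: (x =P b) => [xb|_]; case: (x' =P b) => [x'b|_] e; try congruence;
  first [ by case: (cNS _ e) | by case: (cNS _ (esym e)) | by case: (yNS _ e)
        | by case: (yNS _ (esym e)) | by case: e => /addIn ].
Qed.

Lemma shuttle_misses_bit a b c y : 1 < y -> misses_bit (shuttle a b c y).
Proof.
case: y => [|[|y]] // _.
by case: c => [|c]; [right | left] => x; rewrite /shuttle addnS;
  case: (x == a) => //; case: (x == b).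
Qed.

Variable N : nat.

Lemma zero_congruenceP : congruence (@zero_congruence (collapse_algebra N)).
Proof.
split; first by split=> [x|x y ->|x y z -> ->].
case=> [u|] a b ab; last exact: eq_collapse.
by congr (sval u _); apply: ab.
Qed.

Lemma one_congruenceP : congruence (@one_congruence (collapse_algebra N)).
Proof. by []. Qed.

Lemma congruence_one (d : nat -> nat -> Prop) a b :
  @congruence (collapse_algebra N) d -> d a b -> a <> b -> forall c e, d c e.
Proof.
case=> -[d_refl d_sym d_trans] d_op ab /eqP aNb.
have to_y c y : c < y -> 1 < y -> d c y.
  move=> cy y1.
  pose u : unary_op := exist _ (shuttle a b c y)
    (conj (@shuttle_inj a b c y cy) (@shuttle_misses_bit a b c y y1)).
  have := d_op (Some u) (fun=> a) (fun=> b) (fun=> ab).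
  by rewrite /= /shuttle eqxx eq_sym (negPf aNb) eqxx.
(* [(c + e).+2] exceeds [c], [e] and 1, so both are related to it. *)
move=> c e; apply: (d_trans _ (c + e).+2); last apply: d_sym.
  by apply: to_y => //; rewrite !ltnS ltnW // ltnS leq_addr.
by apply: to_y => //; rewrite !ltnS ltnW // ltnS leq_addl.
Qed.

End Simplicity.

(** * The term condition for equality when [k] exceeds [N] *)

Section TermCondition.

Variables (N k : nat) (V : Type).
Local Notation tm := (term (collapse_algebra N) V).
Local Notation ev := (@eval (collapse_algebra N) V).

Definition is_var (t : tm) : bool := if t is Var _ then true else false.

Lemma compound_misses_bit (t : tm) :
  ~~ is_var t -> misses_bit (fun env : V -> nat => ev env t).
Proof.
case: t => // -[u|] args _; last by left.
by case: (proj2 (svalP u)) => u_neq; [left | right] => env; apply: u_neq.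
Qed.

(** A neighbour of the all-true corner: only a variable that sees coordinate [j] can tell them
    apart. *)
Definition all_but (j i : 'I_k) : bool := i != j.

Lemma all_but_not_all j : ~ forall i, all_but j i.
Proof. by move/(_ j); rewrite /all_but eqxx. Qed.

Hypothesis k_gt1 : 1 < k.

Lemma exists_ord_neq (j : 'I_k) : exists i, i != j.
Proof.
case: k k_gt1 j => [|[|k']] // _ j.
have [->|j0] := eqVneq j ord0; first by exists ord_max.
by exists ord0; rewrite eq_sym.
Qed.

(* [E z] is the valuation at the corner [z] of a cube: a variable belongs to one
   of the tuples and sees only the coordinate of that tuple. *)
Lemma eval_punctured_constant (E : ('I_k -> bool) -> V -> nat) (t : tm) :
  (forall v, exists j : 'I_k, forall z z', z j = z' j -> E z v = E z' v) ->
  (forall z z' : 'I_k -> bool, ~ (forall j, z j) -> ~ (forall j, z' j) ->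
     ev (E z) t = ev (E z') t) ->
  forall j, ev (E (all_but j)) t = ev (E (fun=> true)) t.
Proof.
move=> E_dep tE j.
elim: t tE j => [v|[u|] args IH] tE j /=.
- have [i Ei] := E_dep v; have [i' i'i] := exists_ord_neq i.
  rewrite -(Ei (all_but i') (fun=> true)); last by rewrite /all_but eq_sym.
  exact: (tE _ _ (@all_but_not_all j) (@all_but_not_all i')).
- congr (sval u _); apply: IH => z z' hz hz'.
  exact: (proj1 (svalP u)) (tE z z' hz hz').
have arg_const i : i != ord_max -> forall j,
    ev (E (all_but j)) (args i) = ev (E (fun=> true)) (args i).
  move=> im; apply: IH => z z' hz hz'.
  exact: (proj1 (collapse_inj (tE z z' hz hz'))) _ im.
(* A last variable may vary where it is forgotten, so instead of induction one moves to a corner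
   where it has its all-true value. *)
case last_var: (is_var (args ord_max)).
  case last_eq: (args ord_max) last_var => [v|//] _.
  have [i Ei] := E_dep v; have [i' i'i] := exists_ord_neq i.
  transitivity (ev (E (all_but i')) (@App (collapse_algebra N) V None args)).
    exact: (tE _ _ (@all_but_not_all j) (@all_but_not_all i')).
  apply: eq_collapse => m /=; have [->|/arg_const //] := eqVneq m ord_max.
  by rewrite last_eq /=; apply: Ei; rewrite /all_but eq_sym.
apply: eq_collapse => m; have [->|/arg_const //] := eqVneq m ord_max.
apply: IH => z z' hz hz'.
have [_ [//|[cz cz']]] := collapse_inj (tE z z' hz hz').
apply: (misses_bit_eq (compound_misses_bit (negbT last_var))).
  by have /andP[/forallP/(_ ord_max)] := cz.
by have /andP[/forallP/(_ ord_max)] := cz'.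
Qed.

Hypothesis k_gtN : N < k.

Lemma ord_not_image (g : 'I_N -> 'I_k) : exists j, forall i, j != g i.
Proof.
have /subsetPn[j _ jg] : ~~ ([set: 'I_k] \subset codom g).
  apply: contraL k_gtN => /subset_leq_card; rewrite cardsT card_ord => le_k.
  by rewrite -leqNgt (leq_trans le_k) // (leq_trans (leq_image_card g _)) // card_ord.
exists j => i; apply: contraNneq jg => ->; exact: codom_f.
Qed.

(** The bit [b] selects the values of the last tuple. The hypothesis passes down to all arguments,
    except possibly to a last argument that is a variable of the last tuple. In that case some
    punctured corner gives every argument its all-true value on both sides. *)
Lemma eval_cube (E : bool -> ('I_k -> bool) -> V -> nat) (t : tm) :
  (forall b v, exists j : 'I_k, forall z z', z j = z' j -> E b z v = E b z' v) ->
  (forall v, (forall b z z', E b z v = E b z' v) \/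
             (forall b b' z, E b z v = E b' z v)) ->
  (forall z : 'I_k -> bool, ~ (forall j, z j) ->
     ev (E false z) t = ev (E true z) t) ->
  ev (E false (fun=> true)) t = ev (E true (fun=> true)) t.
Proof.
move=> E_dep E_last.
have j0 : 'I_k by apply: Ordinal (ltnW k_gt1).
elim: t => [v|[u|] args IH] tE /=.
- case: (E_last v) => [Ev|]; last exact.
  by rewrite !(Ev _ _ (all_but j0)); apply: tE (@all_but_not_all j0).
- by congr (sval u _); apply: IH => z /tE /(proj1 (svalP u)).
have arg_eq i : i != ord_max ->
    ev (E false (fun=> true)) (args i) = ev (E true (fun=> true)) (args i).
  by move=> im; apply: IH => z /tE /collapse_inj [+ _]; apply.
have from_last : (forall z : 'I_k -> bool, ~ (forall j, z j) ->
      ev (E false z) (args ord_max) = ev (E true z) (args ord_max)) ->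
    collapse (fun i => ev (E false (fun=> true)) (args i))
    = collapse (fun i => ev (E true (fun=> true)) (args i)).
  move=> /IH last_eq; apply: eq_collapse => i.
  by have [->|/arg_eq] := eqVneq i ord_max.
case last_var: (is_var (args ord_max)); last first.
  apply: from_last => z /tE /collapse_inj [_ [//|[cz cz']]].
  apply: (misses_bit_eq (compound_misses_bit (negbT last_var))
            (x := E false z) (y := E true z)).
    by have /andP[/forallP/(_ ord_max)] := cz.
  by have /andP[/forallP/(_ ord_max)] := cz'.
case last_eq: (args ord_max) last_var => [v|//] _.
case: (E_last v) => [Ev|Ev]; last first.
  by apply: from_last => z _; rewrite last_eq /=.
have [vE|/eqP vN] := eqVneq (E false (fun=> true) v) (E true (fun=> true) v).
  apply: from_last => z _; rewrite last_eq /=.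
  by rewrite !(Ev _ z (fun=> true)).
(* The last values differ at every corner, so each punctured corner must collapse. *)
have bits (z : 'I_k -> bool) : ~ (forall j, z j) ->
    forall i, ev (E false z) (args i) <= 1.
  move=> /tE /collapse_inj [_ []] /=; last by case=> /andP[/forallP].
  by rewrite last_eq /= !(Ev _ z (fun=> true)).
(* The exceptional [j] is the coordinate a variable sees; a compound argument, confined to one bit,
   is constant on the punctured cube, and [j0] is arbitrary. *)
have one_coord (i : 'I_N) : exists j, forall j', j' != j ->
    ev (E false (all_but j')) (args (lift ord_max i))
    = ev (E false (fun=> true)) (args (lift ord_max i)).
  case i_var: (is_var (args (lift ord_max i))).
    case: (args _) i_var => [w|//] _ /=; have [j Ej] := E_dep false w.
    by exists j => j' j'j; apply: Ej; rewrite /all_but eq_sym.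
  exists j0 => j' _.
  apply: (eval_punctured_constant (E := E false)) => // z z' hz hz'.
  exact: (misses_bit_eq (compound_misses_bit (negbT i_var)) (bits z hz _) (bits z' hz' _)).
have [g gP] := fin_all_exists one_coord.
(* At most [N < k] coordinates are exceptional, so some [j] suits all arguments. *)
have [j jg] := ord_not_image g.
have false_eq i : ev (E false (all_but j)) (args i)
    = ev (E false (fun=> true)) (args i).
  case: (unliftP ord_max i) => [i' ->|->]; first exact: gP.
  by rewrite last_eq; apply: Ev.
have true_eq i : ev (E true (all_but j)) (args i)
    = ev (E true (fun=> true)) (args i).
  have [->|im] := eqVneq i ord_max; first by rewrite last_eq; apply: Ev.
  (* Both sides agree on the first [N] arguments at both corners, so [false_eq] transfers. *)
  rewrite -arg_eq // -false_eq; apply: esym.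
  exact: (proj1 (collapse_inj (tE _ (@all_but_not_all j)))) _ im.
rewrite -(eq_collapse false_eq) -(eq_collapse true_eq).
exact: tE (@all_but_not_all j).
Qed.

End TermCondition.

Lemma term_condition_eq N k : 0 < N -> N < k ->
  term_condition k (@zero_congruence (collapse_algebra N)).
Proof.
move=> N_gt0 Nk l t p q tE.
have k_gt1 : 1 < k by apply: leq_ltn_trans Nk.
apply: (eval_cube k_gt1 Nk (E := fun b z => assign p q z b)) => //.
  move=> b [i x]; rewrite /assign /=; case: unlift => [j|].
    by exists j => z z' ->.
  by exists (Ordinal (ltnW k_gt1)).
by move=> [i x]; rewrite /assign /=; case: unlift => [j|]; [right | left].
Qed.

(** * Failure of the term condition for at most [N.+1] tuples *)

Section Failure.

Variables (N k : nat).
Hypothesis kN : k < N.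

(* Every one of the first [k.+1] variables is used, so that a false [z j] puts a
   0 among the first [N] arguments. *)
Definition group_of (i : 'I_N.+1) : 'I_k.+2 :=
  if unlift ord_max i is Some j then lift ord_max (inord (minn j k)) else ord_max.

Definition grouped_term :
    term (collapse_algebra N) {i : 'I_k.+2 & 'I_((fun=> 1) i)} :=
  @App (collapse_algebra N) _ None
    (fun i => Var _ (existT (fun i : 'I_k.+2 => 'I_1) (group_of i) ord0)).

Definition corner (z : 'I_k.+1 -> bool) (b : bool) (i : 'I_N.+1) : nat :=
  if unlift ord_max i is Some j then z (inord (minn j k)) else b.

Lemma eval_grouped_term z b :
  eval (@assign (collapse_algebra N) k.+1 (fun=> 1)
          (fun _ _ => 0) (fun _ _ => 1) z b) grouped_term
  = collapse (corner z b).
Proof.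
apply: eq_collapse => i; rewrite /assign /corner /group_of /=.
case: (unlift _ i) => [j|]; rewrite ?liftK ?unlift_none; last by case: b.
by case: (z _).
Qed.

Lemma corner_collapsible (z : 'I_k.+1 -> bool) b :
  ~ (forall j, z j) -> collapsible (corner z b).
Proof.
move=> /forallP; rewrite negb_forall => /existsP[j zj].
apply/andP; split.
  by apply/forallP => i; rewrite /corner; case: unlift => [?|]; apply: leq_b1.
have jN : j < N := leq_trans (ltn_ord j) kN.
apply/existsP; exists (lift ord_max (Ordinal jN)); rewrite eq_sym neq_lift /=.
rewrite /corner liftK /=; have -> : minn j k = j by apply/minn_idPl; rewrite -ltnS.
by rewrite inord_val (negPf zj).
Qed.

(** At punctured corners [collapse] forgets the last bit, so the premises of the term condition hold
    by reflexivity. At the all-true corner the first [N] entries contain no 0, so the two values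
    differ. *)
Lemma commutator_ones_neq : exists x y,
  @commutator_ones (collapse_algebra N) k.+1 x y /\ x <> y.
Proof.
exists (collapse (corner (fun=> true) false)), (collapse (corner (fun=> true) true)).
split; last first.
  move=> /collapse_inj [_ []]; first by rewrite /corner unlift_none.
  case=> /andP[_ /existsP[i /andP[im]]]; rewrite /corner.
  by case: unliftP im => [j|->]; rewrite ?eqxx.
move=> d d_congr d_tc; rewrite -!eval_grouped_term; apply: d_tc => z hz.
rewrite !eval_grouped_term (collapse_forget (y := corner z true)) //.
- by case: d_congr => -[].
- move=> i im; rewrite /corner; case: unliftP im => [//|->]; by rewrite eqxx.
- exact: corner_collapsible.
- exact: corner_collapsible.
Qed.

End Failure.

Lemma congruence_same_rel (A : algebra) (d e : A -> A -> Prop) :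
  same_rel d e -> congruence e -> congruence d.
Proof.
move=> de [[e_refl e_sym e_trans] e_op]; split; first split.
- by move=> x; apply/de.
- by move=> x y /de /e_sym /de.
- by move=> x y z /de xy /de yz; apply/de; apply: e_trans xy yz.
- by move=> f a b ab; apply/de; apply: e_op => i; apply/de.
Qed.

Lemma collapse_algebra_simple N : simple (collapse_algebra N).
Proof.
split; first by move/(_ 0 1) => [_ /(_ I)].
move=> d; split=> [d_congr|]; last first.
  by case=> dE; apply: congruence_same_rel dE _;
     [apply: zero_congruenceP | apply: one_congruenceP].
have [[a [b [ab aNb]]]|d_eq] := classic (exists a b, d a b /\ a <> b).
  by right=> x y; split=> _ //; apply: congruence_one d_congr ab aNb x y.
left=> x y; split=> [xy|->]; last by case: d_congr => -[].
by apply: NNPP => xNy; apply: d_eq; exists x, y.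
Qed.

Theorem theorem4p6 (n : nat) (hn : 2 <= n) :
  exists A : algebra,
    simple A /\
    (forall m : nat, 1 <= m <= n ->
       same_rel (@central_series A m) (@one_congruence A)) /\
    (forall m : nat, n < m ->
       same_rel (@central_series A m) (@zero_congruence A)).
Proof.
(* With [n = N.+1] and [m = k.+2], the bounds [m <= n] and [n < m] become [k < N] and [N < k.+1]. *)
case: n hn => [|N] // N_gt0; exists (collapse_algebra N).
split; first exact: collapse_algebra_simple.
split=> [[|[|k]] //= kN x y|[|[|k]] //= Nk x y].
  split=> _ //; have [a [b [ab aNb]]] := @commutator_ones_neq N k kN.
  have [comm_congr _ _] := commutator_ones_smallest (collapse_algebra N) k.+1.
  exact: congruence_one comm_congr ab aNb x y.
have [comm_congr _ comm_min] := commutator_ones_smallest (collapse_algebra N) k.+1.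
split=> [|->]; last by case: comm_congr => -[].
by apply: comm_min; [apply: zero_congruenceP | apply: term_condition_eq].
Qed.
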